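(* Let $p \in [1, +\infty)$, $A \in \mathcal M_d(\mathbb R)$, and let $\tau$ be a bounded delay function such that, with $\sigma_1(t) = t - \tau(t)$ for $t \in \mathbb R_+$: - $\inf_{s \in [0, t]} \tau(s) > 0$ for every $t \geq 0$; - $\tau$ is $(\mathfrak L, \mathfrak L)$-measurable, $\mathcal L(\sigma_1^{-1}(N)) = 0$ for every $N \in \mathfrak L$ with $\mathcal L(N) = 0$, the measure ${\sigma_1}_{\#} \mathcal L$ is $\sigma$-finite, and the Radon--Nikodym derivative $\varphi$ of ${\sigma_1}_{\#}\mathcal L$ with respect to $\mathcal L$ is bounded and satisfies $\lVert\varphi\rVert_{L^\infty(\mathbb R, \mathbb R)}\, \rho(A)^p < 1$. Let $h$ be the largest delay function associated with $\tau$. Then there exist positive constants $C$ and $\gamma$ such that, for every $L^p$ solution $x \in L^p_{\mathrm{loc}}(\lvert -h(0), +\infty), \mathbb R^d)$ of $$x(t) = A x(t - \tau(t)), \qquad t \geq 0,$$ with initial condition $x_0 \in L^p(\lvert -h(0), 0), \mathbb R^d)$, we have $x \in L^p(\lvert -h(0), +\infty), \mathbb R^d)$ and $$\lVert x_t\rVert_{L^p(\lvert -h(t), 0), \mathbb R^d)} \leq C e^{-\gamma t} \lVert x_0\rVert_{L^p(\lvert -h(0), 0), \mathbb R^d)} \qquad \text{for every } t \in \mathbb R_+.$$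
   Context: $\mathbb R_+ = [0, +\infty)$, $\mathbb R_+^\ast = (0, +\infty)$; $\mathcal M_d(\mathbb R)$ is the set of real $d \times d$ matrices, $d$ a positive integer, and $\rho(A)$ is the spectral radius of $A$; $\mathfrak L$, $\mathfrak B$ are the Lebesgue and Borel $\sigma$-algebras and $\mathcal L$ is Lebesgue measure. A map $f\colon X \to Y$ is $(\mathfrak S_X, \mathfrak S_Y)$-measurable if $f^{-1}(B) \in \mathfrak S_X$ for all $B \in \mathfrak S_Y$; ${\sigma_1}_{\#}\mathcal L$ is the push-forward by $\sigma_1\colon \mathbb R_+ \to \mathbb R$ of Lebesgue measure on $\mathbb R_+$, a measure on $(\mathbb R, \mathfrak L)$. For $a \leq b$ in $\mathbb R \cup \{\pm\infty\}$, the interval $\lvert a, b)$ denotes $[a, b)$ if $a > -\infty$ and $(a, b)$ if $a = -\infty$. A \emph{delay function} is any function $\tau\colon \mathbb R_+ \to \mathbb R_+^\ast$. Its \emph{largest delay function} is $h\colon \mathbb R_+ \to \mathbb R_+^\ast \cup \{+\infty\}$, $h(t) = t - \inf_{s \in [t, +\infty)} (s - \tau(s))$. An \emph{a.e. solution} is a function $x\colon \lvert -h(0), +\infty) \to \mathbb R^d$ such that, for every $\widetilde x\colon \lvert -h(0), +\infty) \to \mathbb R^d$ equal to $x$ a.e., we have $\widetilde x(t) = A \widetilde x(t - \tau(t))$ for a.e. $t \in \mathbb R_+$. An \emph{$L^p$ solution} is an $(\mathfrak L, \mathfrak B)$-measurable a.e. solution $x$ with $x \in L^p_{\mathrm{loc}}(\lvert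 -h(0), +\infty), \mathbb R^d)$. Its \emph{initial condition} is its restriction to $\lvert -h(0), 0)$. For $t \in \mathbb R_+$, $x_t\colon \lvert -h(t), 0) \to \mathbb R^d$ is defined by $x_t(s) = x(t + s)$. *)

(* Defs.v *)
From HB Require Import structures.
From mathcomp Require Import all_boot all_order all_algebra.
From mathcomp Require Import all_classical all_reals all_analysis.
From mathcomp Require Import complex.

Set Implicit Arguments.
Unset Strict Implicit.
Unset Printing Implicit Defensive.

Import Order.TTheory GRing.Theory Num.Theory.
Import numFieldNormedType.Exports.

Local Open Scope classical_set_scope.
Local Open Scope ring_scope.

(* The real line with the Lebesgue sigma-algebra: the carrier is R, and its
   measurable sets are the Caratheodory-measurable ones, i.e. the completion of
   the Borel sets (lemma completed_caratheodory_measurable). *)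
Notation lebR R := (caratheodory_type ((wlength (R := R) idfun)^*)%mu).

Notation leb := completed_lebesgue_measure.

(* R^d with its Borel sigma-algebra; 'cV[R]_d carries the library's (sup) norm,
   and the choice of the norm on R^d is immaterial since all are equivalent. *)
Notation borel_cV R d := (g_sigma_algebraType [set U : set 'cV[R]_d | open U]).

Section SpectralRadius.
Context {R : realType}.

(* [eigenvalue] is about left eigenvectors, which gives the same spectrum. *)
Definition spectral_radius (d : nat) (A : 'M[R]_d) : R :=
  sup [set Normc.normc l | l in
        [set l : R[i] | eigenvalue (map_mx (real_complex R) A) l]].

End SpectralRadius.

Section LpSpaces.
Context {R : realType}.
Local Open Scope ereal_scope.

(* |a, b) : it is [a, b) if a is finite, and (-oo, b) if a = -oo. *)
Definition half_open (a b : \bar R) : set R := [set s | a <= s%:E < b].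

Definition Rplus : set R := [set t | (0 <= t)%R].

Variable d : nat.
Implicit Types (D : set R) (p : R) (x : R -> 'cV[R]_d).

Definition LB_measurable D x :=
  measurable_fun (D : set (lebR R)) (x : lebR R -> borel_cV R d).

Definition Lp_norm D p x : \bar R :=
  'N[leb]_p%:E[(fun s : lebR R => `|x s|%:E) \_ D].

Definition Lp D p x := LB_measurable D x /\ Lp_norm D p x < +oo.

Definition Lp_loc D p x :=
  LB_measurable D x /\
  forall K : set R, K `<=` D -> compact K -> Lp K p x.

End LpSpaces.

Section RadonNikodym.
Context {R : realType}.
Local Open Scope ereal_scope.

(* The library's Radon-Nikodym derivative is restricted to finite measures. *)
Definition is_Radon_Nikodym (nu : set (lebR R) -> \bar R) (phi : lebR R -> R) :=
  [/\ (forall y, (0 <= phi y)%R),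
      measurable_fun [set: lebR R] phi &
      forall B : set (lebR R), measurable B ->
        nu B = \int[leb]_(y in B) (phi y)%:E].

Definition Linfty_norm (phi : lebR R -> R) : \bar R :=
  'N[leb]_+oo[EFin \o phi].

End RadonNikodym.

(* Functions on R_+ and on |-h(0), +oo) are represented by functions on R whose
   values outside of these domains are never used. *)
Section Delay.
Context {R : realType}.
Implicit Types tau : R -> R.

Definition delay_function tau := forall t, 0 <= t -> 0 < tau t.

Definition bounded_delay tau := exists M : R, forall t, 0 <= t -> tau t <= M.

Definition sigma1 tau : R -> R := fun t => t - tau t.

Definition largest_delay tau (t : R) : \bar R :=
  (t%:E - ereal_inf [set (s - tau s)%:E | s in `[t, +oo[])%E.

Definition pushforward_sigma1 tau : set (lebR R) -> \bar R :=
  pushforward (fun E : set (lebR R) => leb (E `&` Rplus))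
    (sigma1 tau : lebR R -> lebR R).

Definition sol_domain tau : set R := half_open (- largest_delay tau 0)%E +oo%E.

Definition init_domain tau (t : R) : set R :=
  half_open (- largest_delay tau t)%E 0%E.

Definition history (d : nat) (x : R -> 'cV[R]_d) (t : R) : R -> 'cV[R]_d :=
  fun s => x (t + s).

Definition ae_solution (d : nat) (A : 'M[R]_d) tau (x : R -> 'cV[R]_d) :=
  forall y : R -> 'cV[R]_d,
    (\forall t \ae (@leb R), sol_domain tau t -> y t = x t) ->
    \forall t \ae (@leb R), Rplus t -> y t = A *m y (t - tau t).

Definition Lp_solution (d : nat) (p : R) (A : 'M[R]_d) tau
    (x : R -> 'cV[R]_d) :=
  ae_solution A tau x /\ Lp_loc (sol_domain tau) p x.

End Delay.

(* Main.v *)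
(** A delay equation contracts in a weighted L^p norm.  Fix r > rho(A) and a norm N
    with N(Av) <= r N(v), and put F(t) = (e^(gamma t) N(x(t)))^p.  Then
    F(t) <= L F(t - tau(t)) for a.e. t >= 0, with L = (e^(gamma M) r)^p and M a bound
    for tau.  The pushforward of Lebesgue measure by t - tau(t) is at most
    K = ||phi||_oo times Lebesgue measure, so integrating over [0, T] gives
    int_[0,T] F <= K L (int_[-h(0),0] F + int_[0,T] F).  For r close to rho(A) and
    gamma small, K L < 1; as int_[0,T] F is finite, it can be absorbed in the
    left-hand side, which bounds int F over the whole half-line by the initial
    data.  The weight e^(gamma p t) then yields the exponential decay. *)
Require Import Defs.
From HB Require Import structures.
From mathcomp Require Import all_boot all_order all_algebra.
From mathcomp Require Import all_classical all_reals all_analysis.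
From mathcomp Require Import complex.
From mathcomp Require Import lra ring.
From mathcomp Require Import measurable_realfun ess_sup_inf.

Set Implicit Arguments.
Unset Strict Implicit.
Unset Printing Implicit Defensive.

Import Order.TTheory GRing.Theory Num.Theory.
Import numFieldNormedType.Exports.

Local Open Scope classical_set_scope.
Local Open Scope ring_scope.

(** * A norm adapted to the spectral radius *)

Section WeightedNorm.
Context {R : realType}.
Variables (d : nat) (delta : R).
Hypothesis delta_gt0 : 0 < delta.

(** A weighted l^1 norm, for which operator bounds are read off weighted column sums. It lives on
    complex vectors because a real matrix is triangularized over the complex numbers. *)
Definition wnorm (u : 'cV[R[i]]_d) : R :=
  \sum_(k < d) delta ^+ k * Normc.normc (u k 0).

Lemma normc_ge0 (z : R[i]) : 0 <= Normc.normc z.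
Proof. by case: z => a b; exact: sqrtr_ge0. Qed.

Lemma le_normc_sum (n : nat) (F : 'I_n -> R[i]) :
  Normc.normc (\sum_(i < n) F i) <= \sum_(i < n) Normc.normc (F i).
Proof.
elim/big_ind2 : _ => [|x1 x2 y1 y2 h1 h2|//]; first by rewrite Normc.normc0.
exact: le_trans (le_normcD _ _) (lerD h1 h2).
Qed.

Lemma normc_real (a : R) : Normc.normc (real_complex R a) = `|a|.
Proof. by rewrite /Normc.normc /= expr0n/= addr0 sqrtr_sqr. Qed.

Lemma wnorm_ge0 (u : 'cV[R[i]]_d) : 0 <= wnorm u.
Proof.
apply: sumr_ge0 => k _.
by rewrite mulr_ge0 ?normc_ge0 ?exprn_ge0 ?(ltW delta_gt0).
Qed.

Lemma wnorm_mulmx (B : 'M[R[i]]_d) (b : R) :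
  (forall k, \sum_(i < d) delta ^+ i * Normc.normc (B i k) <= b * delta ^+ k) ->
  forall u, wnorm (B *m u) <= b * wnorm u.
Proof.
move=> hb u; rewrite /wnorm.
apply: (@le_trans _ _ (\sum_(k < d)
    (\sum_(i < d) delta ^+ i * Normc.normc (B i k)) * Normc.normc (u k 0))).
  under [leRHS]eq_bigr do rewrite mulr_suml.
  rewrite exchange_big /=; apply: ler_sum => i _.
  rewrite mxE -(eq_bigr _ (fun k _ => mulrA _ _ _)) -mulr_sumr.
  apply: ler_wpM2l; first by rewrite exprn_ge0 // ltW.
  apply: le_trans (le_normc_sum _) _.
  by apply: ler_sum => k _; rewrite Normc.normcM.
rewrite mulr_sumr; apply: ler_sum => k _.
by rewrite mulrA ler_wpM2r ?normc_ge0.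
Qed.

Lemma wnorm_bounded (B : 'M[R[i]]_d) :
  exists2 b, 0 < b & forall u, wnorm (B *m u) <= b * wnorm u.
Proof.
pose f k := \sum_(i < d) delta ^+ i * Normc.normc (B i k) / delta ^+ k.
have f0 k : 0 <= f k.
  apply: sumr_ge0 => i _; have := ltW delta_gt0 => d0.
  by rewrite divr_ge0 ?mulr_ge0 ?exprn_ge0 ?normc_ge0.
exists (1 + \sum_(k < d) f k); first by rewrite ltr_pwDl ?sumr_ge0.
apply: wnorm_mulmx => k; rewrite -ler_pdivrMr ?exprn_gt0 // mulr_suml.
by rewrite -/(f k) (bigD1 k) //=; apply: ler_wpDl => //; rewrite lerDl sumr_ge0.
Qed.

Lemma wnorm_le_normD u v : wnorm (u + v) <= wnorm u + wnorm v.
Proof.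
rewrite /wnorm -big_split /=; apply: ler_sum => k _.
by rewrite -mulrDr ler_wpM2l ?exprn_ge0 ?(ltW delta_gt0)// mxE le_normcD.
Qed.

Lemma le_wnorm_coord (u : 'cV[R[i]]_d) (k : 'I_d) :
  delta ^+ k * Normc.normc (u k 0) <= wnorm u.
Proof.
rewrite /wnorm (bigD1 k) //= lerDl sumr_ge0 // => i _.
by rewrite mulr_ge0 ?normc_ge0 ?exprn_ge0 ?(ltW delta_gt0).
Qed.

End WeightedNorm.

Lemma eigenvalue_trig (F : fieldType) (d : nat) (T : 'M[F]_d) (l : F) :
  is_trig_mx T -> eigenvalue T l = [exists i, l == T i i].
Proof.
move=> trT; rewrite eigenvalue_root_char char_poly_trig // rootE horner_prod.
apply/idP/existsP => [/prodf_eq0 [i _]|[i /eqP ->]].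
  by rewrite hornerXsubC subr_eq0 => h; exists i.
by rewrite (bigD1 i)//= hornerXsubC subrr mul0r.
Qed.

Lemma char_poly_conj (F : fieldType) (d : nat) (P A : 'M[F]_d) :
  P \in unitmx -> char_poly (P *m A *m invmx P) = char_poly A.
Proof.
move=> uP; rewrite /char_poly /char_poly_mx.
have uP' : map_mx polyC P \in unitmx by rewrite map_unitmx.
have -> : 'X%:M - map_mx polyC (P *m A *m invmx P) =
    map_mx polyC P *m ('X%:M - map_mx polyC A) *m invmx (map_mx polyC P).
  rewrite mulmxBr mulmxBl !map_mxM map_invmx; congr (_ - _).
  by rewrite scalar_mxC mulmxK.
by rewrite !det_mulmx mulrAC -det_mulmx mulmxV // det1 mul1r.
Qed.

Section AdaptedNorm.
Context {R : realType}.

(** Similar matrices have the same characteristic polynomial, so the spectrum of [A] is the diagonal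
    of its triangular conjugate. *)
Lemma spectral_radius_trig (d : nat) (A : 'M[R]_d) (P : 'M[R[i]]_d) :
  P \in unitmx -> is_trig_mx (P *m map_mx (real_complex R) A *m invmx P) ->
  forall k, Normc.normc ((P *m map_mx (real_complex R) A *m invmx P) k k)
    <= spectral_radius A.
Proof.
rewrite /spectral_radius; move: (map_mx _ A) => AC uP trT k.
have eig l : eigenvalue AC l =
    [exists i, l == (P *m AC *m invmx P) i i].
  by rewrite eigenvalue_root_char -(char_poly_conj AC uP)
    -eigenvalue_root_char eigenvalue_trig.
move: (P *m AC *m invmx P) {trT} eig => T eig.
apply: ub_le_sup; last first.
  by exists (T k k) => //=; rewrite eig; apply/existsP; exists k.
(* An upper bound for the moduli: [sup] dominates the elements of a set once that set is bounded
   above. *)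
exists (\sum_i Normc.normc (T i i)) => _ [l /= + <-].
rewrite eig => /existsP[i /eqP ->].
rewrite (bigD1 i) //= lerDl sumr_ge0 // => j _.
exact: normc_ge0.
Qed.

(* In a basis where A is triangular, weighting the k-th coordinate by delta^k
   multiplies the off-diagonal entries by at most delta. *)
Lemma adapted_norm (d : nat) (A : 'M[R]_d) (r : R) : (0 < d)%N ->
  spectral_radius A < r ->
  exists (N : 'cV[R]_d -> R) (c : R), [/\ 0 < c, continuous N,
    forall v, `|v| <= c * N v, forall v, N v <= c * `|v| &
    forall v, N (A *m v) <= r * N v].
Proof.
move=> hd hr; set AC := map_mx (real_complex R) A.
have [P Pu trT] := Schur AC hd.
have {}Pu : P \in unitmx by exact: unitarymx_unit.
have {}trT : is_trig_mx (P *m AC *m invmx P).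
  by rewrite -conjumx //; exact: trT.
set T := P *m AC *m invmx P in trT.
have hT := spectral_radius_trig Pu trT.
set rho := spectral_radius A in hr hT.
pose S := \sum_i \sum_k Normc.normc (T i k).
have S0 : 0 <= S by rewrite sumr_ge0 // => i _; rewrite sumr_ge0 // => k _; exact: normc_ge0.
(* The bound 1 makes higher powers of [delta] smaller; the other one gives [delta * S <= r - rho],
   which fits the off-diagonal entries into the gap between [rho] and [r]. Using [S + 1] avoids a
   division by zero. *)
pose delta := Num.min 1 ((r - rho) / (S + 1)).
have delta_gt0 : 0 < delta.
  by rewrite /delta lt_min ltr01 divr_gt0 // ?subr_gt0 // ltr_wpDl.
have delta_le1 : delta <= 1 by rewrite ge_min lexx.
have deltaS : delta * S <= r - rho.
  apply: (@le_trans _ _ (delta * (S + 1))); first by rewrite ler_pM2l // lerDl.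
  by rewrite -ler_pdivlMr ?ltr_wpDl // ge_min lexx orbT.
have TW : forall u, wnorm delta (T *m u) <= r * wnorm delta u.
  apply: wnorm_mulmx => // k.
  rewrite (bigD1 k) //=.
  have -> : r * delta ^+ k = delta ^+ k * rho + delta ^+ k * (r - rho) by ring.
  apply: lerD; first by rewrite ler_wpM2l // exprn_ge0 // ltW.
  apply: le_trans (ler_wpM2l _ deltaS); last by rewrite exprn_ge0 // ltW.
  apply: (@le_trans _ _ (\sum_(i < d) delta ^+ k * delta * Normc.normc (T i k))).
    rewrite [leRHS](bigD1 k) //= ler_wpDl //.
      by rewrite !mulr_ge0 ?exprn_ge0 ?normc_ge0 // ltW.
    (* [T] is lower triangular: below the diagonal [delta ^+ i] is at most [delta ^+ k * delta],
       above it the entry is zero. *)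
    apply: ler_sum => i ik; have [ki|] := ltnP k i.
      rewrite ler_wpM2r ?normc_ge0 // -exprSr.
      by apply: ler_wiXn2l => //; rewrite ltW.
    rewrite leq_eqVlt (inj_eq val_inj) (negbTE ik) /= => {}ik.
    move/is_trig_mxP : trT => -> //; rewrite Normc.normc0 mulr0.
    by rewrite !mulr_ge0 // ?exprn_ge0 // ltW.
  rewrite -mulr_sumr -mulrA ler_wpM2l ?exprn_ge0 ?(ltW delta_gt0) //.
  rewrite ler_wpM2l ?(ltW delta_gt0) // /S; apply: ler_sum => i _.
  by rewrite (bigD1 k) //= lerDl sumr_ge0 // => j _; exact: normc_ge0.
pose E (v : 'cV[R]_d) := map_mx (real_complex R) v.
pose N v := wnorm delta (P *m E v).
have [b b0 hb] := wnorm_bounded delta_gt0 P.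
have [b' b'0 hb'] := wnorm_bounded delta_gt0 (invmx P).
have EW v : wnorm delta (E v) <= d%:R * `|v|.
  rewrite /wnorm -[d in d%:R]card_ord -sum1_card natr_sum mulr_suml.
  apply: ler_sum => k _; rewrite mul1r mxE normc_real.
  apply: (@le_trans _ _ (1 * `|v k 0|)).
    by rewrite ler_wpM2r // exprn_ile1 // ltW.
  rewrite mul1r [leRHS]mx_normrE.
  exact: (le_bigmax _ (fun ij : 'I_d * 'I_1 => `|v ij.1 ij.2|) (k, 0)).
have N1 v : N v <= b * d%:R * `|v|.
  by rewrite /N; apply: le_trans (hb _) _; rewrite -mulrA ler_pM2l.
(* Inverting [P] recovers [E v], and every weight [delta ^+ k] is at least [delta ^+ d]. *)
have N2 v : `|v| <= (b' * delta ^- d) * N v.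
  have cN : 0 <= b' * delta ^- d * N v.
    rewrite mulr_ge0 ?wnorm_ge0 ?mulr_ge0 ?invr_ge0 ?exprn_ge0 //; exact: ltW.
  rewrite [leLHS]mx_normrE; apply: bigmax_le => // -[k j] _ /=.
  rewrite ord1 -normc_real.
  have -> : real_complex R (v k 0) = E v k 0 by rewrite mxE.
  rewrite mulrAC ler_pdivlMr ?exprn_gt0 // mulrC.
  apply: (@le_trans _ _ (delta ^+ k * Normc.normc (E v k 0))).
    rewrite ler_wpM2r ?normc_ge0 //; by apply: ler_wiXn2l => //; [exact: ltW|exact: ltnW].
  apply: le_trans (le_wnorm_coord delta_gt0 _ _) _.
  by rewrite -[E v in leLHS](mulKmx Pu).
have ND u v : N (u + v) <= N u + N v.
  rewrite /N /E map_mxD mulmxDr; exact: wnorm_le_normD.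
have dR : 0 < d%:R :> R by rewrite ltr0n.
exists N, (b * d%:R + b' * delta ^- d); split.
- by rewrite addr_gt0 // ?mulr_gt0 // invr_gt0 exprn_gt0.
- move=> v; apply/(@cvgrPdist_lt _ _ _ _ (@nbhs_filter 'cV[R]_d v)) => e e0.
  have N0 : 0 < b * d%:R by rewrite mulr_gt0.
  (* Subadditivity and the upper bound [N1] make [N] Lipschitz, hence continuous. *)
  have h u1 u2 : N u1 - N u2 <= b * d%:R * `|u1 - u2|.
    by apply: le_trans (N1 _); rewrite lerBlDr -{1}[u1](subrK u2) ND.
  have e'0 : 0 < (b * d%:R)^-1 * e by rewrite mulr_gt0 ?invr_gt0.
  have /cvgrPdist_lt /(_ _ e'0) : (id : 'cV[R]_d -> 'cV[R]_d) @ v --> v.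
    exact: cvg_id.
  apply: filterS => w; rewrite ltr_pdivlMl //; apply: le_lt_trans.
  by rewrite ler_norml h andbT lerNl opprB distrC h.
- move=> v; apply: le_trans (N2 v) _; rewrite ler_wpM2r //.
    exact: wnorm_ge0.
  by rewrite lerDr mulr_ge0 // ltW.
- move=> v; apply: le_trans (N1 v) _; rewrite ler_wpM2r // lerDl.
  by rewrite mulr_ge0 ?invr_ge0 ?exprn_ge0 // ltW.
(* In the new basis [A] acts as [T], that is, [P A = T P]. *)
- move=> v; rewrite /N; apply: le_trans (TW _); rewrite /T -!mulmxA mulKmx //.
  by rewrite /E map_mxM.
Qed.

End AdaptedNorm.

(** * Changes of variables in integrals *)

Section Domination.
Import HBNNSimple.
Local Open Scope ereal_scope.

(** The integral is a supremum over simple functions below [f], and for these the domination holds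
    level set by level set. *)
Lemma ge0_integral_le_measure d (T : measurableType d) (R : realType)
    (nu mu : {measure set T -> \bar R}) (f : T -> \bar R) :
  (forall B, measurable B -> nu B <= mu B) -> (forall x, 0 <= f x) ->
  \int[nu]_x f x <= \int[mu]_x f x.
Proof.
move=> numu f0; rewrite !ge0_integralTE //.
apply: ge_ereal_sup => _ [h /= hf <-].
apply: le_trans (ereal_sup_ubound _); last by exists h.
rewrite !sintegralE; apply: lee_fsum => [|_ [x _ <-]]; first exact: fimfunP.
apply: lee_wpmul2l; first by rewrite lee_fin.
by apply: numu; rewrite -[X in measurable X]setTI; exact: measurable_funP.
Qed.

(** The left-hand side is at most the integral of [g] against the pushforward by [s] of [mu]
    restricted to [D], a measure dominated by [K] times [mu']. *)
Lemma ge0_integral_comp_le d d' (T : measurableType d) (U : measurableType d')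
    (R : realType) (mu : {measure set T -> \bar R})
    (mu' : {measure set U -> \bar R}) (s : T -> U) (D : set T) (K : {nonneg R})
    (g : U -> \bar R) : measurable D -> measurable_fun [set: T] s ->
  (forall B, measurable B -> mu (s @^-1` B `&` D) <= K%:num%:E * mu' B) ->
  measurable_fun [set: U] g -> (forall y, 0 <= g y) ->
  \int[mu]_(t in D) g (s t) <= K%:num%:E * \int[mu']_y g y.
Proof.
move=> mD ms h mg g0.
pose smix := isMeasurableFun.Build _ _ _ _ _ ms.
pose sm : {mfun T >-> U} := HB.pack s smix.
rewrite (@eq_measure_integral _ _ _ _ (mrestr mu mD)); last first.
  by move=> A mA AD /=; rewrite /mrestr setIidl.
apply: (@le_trans _ _ (\int[mrestr mu mD]_t g (s t))).
  apply: ge0_subset_integral => //; exact: measurableT_comp.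
rewrite -(ge0_integral_mscale mu' measurableT K mg) //.
rewrite -[leLHS]/(\int[mrestr mu mD]_(t in sm @^-1` setT) (g \o sm) t).
rewrite -(@ge0_integral_pushforward _ _ _ _ _ _ ms) //.
apply: (@ge0_integral_le_measure _ _ _ (pushforward (mrestr mu mD) sm) (mscale K mu')) => //.
Qed.

End Domination.

(** * Completed Lebesgue measure *)

Section Lebesgue.
Context {R : realType}.
Local Open Scope ereal_scope.

Lemma leb_mu_ext (X : set R) : leb X = (wlength (R := R) idfun)^*%mu X.
Proof. by []. Qed.

Lemma borel_leb (B : set R) : measurable B -> measurable (B : set (lebR R)).
Proof. exact: sub_caratheodory. Qed.

(** Translating a cover by half-open intervals keeps all lengths. The set is arbitrary because
    Caratheodory measurability is tested on arbitrary sets. *)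
Lemma le_leb_translate (c : R) (X : set R) :
  leb ((fun s => c + s)%R @^-1` X) <= leb X.
Proof.
rewrite !leb_mu_ext; apply: le_ereal_inf_tmp => _ [F [mF XF] <-].
apply: ereal_inf_lbound; exists (fun k => (fun s => c + s)%R @^-1` F k).
  split=> [k|s /XF [k _ Fk]]; last by exists k.
  have /ocitvP [->|[[a b] /= ab ->]] := mF k.
    by rewrite preimage_set0; exact: measurable0.
  exists (a - c, b - c)%R => //; apply/seteqP; split=> s /=;
    rewrite !in_itv /= => /andP[h1 h2]; apply/andP; split; lra.
apply: eq_eseriesr => k _.
have /ocitvP [->|[[a b] /= ab ->]] := mF k; first by rewrite preimage_set0.
have -> : ((fun s => c + s)%R @^-1` `]a, b])%classic = `](a - c)%R, (b - c)%R]%classic.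
  by apply/seteqP; split=> s /=;
    rewrite !in_itv /= => /andP[h1 h2]; apply/andP; split; lra.
rewrite !wlength_itv_bnd ?ltW //; last by lra.
by rewrite /=; congr (_%:E); ring.
Qed.

Lemma leb_translate (c : R) (X : set R) :
  leb ((fun s => c + s)%R @^-1` X) = leb X.
Proof.
apply/eqP; rewrite eq_le le_leb_translate /=.
apply: le_trans (le_leb_translate (- c) _).
by rewrite -comp_preimage (_ : _ \o _ = id) //; apply/funext => s /=; ring.
Qed.

(** The Caratheodory criterion involves only the translation-invariant outer measure: testing the
    preimage on [X] amounts to testing [B] on the translate [Y] of [X]. *)
Lemma measurable_translate (c : R) :
  measurable_fun [set: lebR R] ((fun s => c + s)%R : lebR R -> lebR R).
Proof.
move=> _ B mB; rewrite setTI; move=> X.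
pose Y := (fun s => - c + s)%R @^-1` X.
have XY : X = (fun s => c + s)%R @^-1` Y.
  by rewrite /Y -comp_preimage (_ : _ \o _ = id) //; apply/funext => s /=; ring.
rewrite XY preimage_setC -!preimage_setI.
apply: (etrans (leb_translate c Y)); apply: (etrans (mB Y)).
by congr (_ + _); apply/esym; exact: leb_translate.
Qed.

(** A Lebesgue set is a Borel set together with a subset of a Borel null set. The preimage of the
    former is measurable, that of the latter is negligible, hence measurable by completeness. *)
Lemma measurable_leb_fun (s : lebR R -> lebR R) :
  measurable_fun [set: lebR R] (s : lebR R -> measurableTypeR R) ->
  (forall N : set (lebR R), measurable N -> leb N = 0 ->
    (@leb R).-negligible (s @^-1` N)) ->
  measurable_fun [set: lebR R] s.
Proof.
move=> ms snull _ B mB; rewrite setTI.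
have : completed_algebra_gen lebesgue_measure B.
  by rewrite -g_sigma_completed_algebra_genE completed_caratheodory_measurable.
move=> [B' mB' [N [N' [mN' N'0 NN']] <-]].
rewrite preimage_setU; apply: measurableU.
  by rewrite -[X in measurable X]setTI; exact: ms.
apply: negligible_sub_caratheodory.
apply: (@negligibleS _ _ _ _ (s @^-1` N')) => //; first exact: preimage_subset.
by apply: snull => //; exact: borel_leb.
Qed.

Lemma measurable_itv_leb (i : interval R) : measurable ([set` i] : set (lebR R)).
Proof. exact: (borel_leb (measurable_itv i)). Qed.

Lemma measurable_id_borel :
  measurable_fun [set: lebR R] (id : lebR R -> R).
Proof. by move=> _ B mB; rewrite setTI; exact: borel_leb. Qed.

End Lebesgue.

(** * Absorption and exhaustion for integrals of nonnegative functions *)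

Section Contraction.
Local Open Scope ereal_scope.
Context d (T : measurableType d) (R : realType) (mu : {measure set T -> \bar R}).

(** With [x] and [y] the integrals over [D0] and [D1], the change of variables gives
    [y <= K L (x + y)]. Finiteness makes both real numbers, so the inequality can be solved for
    [x + y]. *)
Lemma integral_contraction (D0 D1 : set T) (s : T -> T) (K L : {nonneg R})
    (f : T -> R) :
  measurable D0 -> measurable D1 -> [disjoint D0 & D1] ->
  (forall t, 0 <= f t)%R -> measurable_fun (D0 `|` D1) f ->
  measurable_fun [set: T] s -> (forall t, D1 t -> (D0 `|` D1) (s t)) ->
  (forall B, measurable B -> mu (s @^-1` B `&` D1) <= K%:num%:E * mu B) ->
  {ae mu, forall t, D1 t -> (f t <= L%:num * f (s t))%R} ->
  (K%:num * L%:num < 1)%R -> \int[mu]_(t in D0 `|` D1) (f t)%:E < +oo ->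
  \int[mu]_(t in D0 `|` D1) (f t)%:E <=
    ((1 - K%:num * L%:num)^-1)%:E * \int[mu]_(t in D0) (f t)%:E.
Proof.
move=> mD0 mD1 D01 f0 mf ms sD sK fs KL.
have mD : measurable (D0 `|` D1) by exact: measurableU.
have mfE : measurable_fun (D0 `|` D1) (EFin \o f) by exact/measurable_EFinP.
(* Extending [f] by zero gives a function on the whole space; on [D1] the composite with [s] is
   unchanged, as [s] takes its values in [D0] or [D1] there. *)
pose g := (EFin \o f) \_ (D0 `|` D1).
have mg : measurable_fun [set: T] g by exact/(measurable_restrictT _ _).1.
have g0 t : 0 <= g t by apply: erestrict_ge0 => x _; rewrite lee_fin.
have int_g : \int[mu]_t g t = \int[mu]_(t in D0 `|` D1) (f t)%:E.
  by rewrite -integral_mkcond.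
have mgs (E : set T) : measurable_fun E (g \o s).
  by apply: measurable_funTS; exact: measurableT_comp.
have ID1 : \int[mu]_(t in D1) (f t)%:E <=
    (K%:num * L%:num)%:E * \int[mu]_(t in D0 `|` D1) (f t)%:E.
  apply: (@le_trans _ _ (\int[mu]_(t in D1) (L%:num%:E * (g \o s) t))).
    apply: ae_ge0_le_integral => //.
    - by move=> t _; rewrite lee_fin.
    - by apply: measurable_funS mfE => //; exact: subsetUr.
    - by move=> t _; apply: mule_ge0; [rewrite lee_fin|exact: g0].
    - exact: measurable_funeM.
    apply: filterS fs => t ft D1t.
    by rewrite /g /= patchE mem_set ?lee_fin ?ft //; exact: sD.
  rewrite ge0_integralZl_EFin //.
  rewrite EFinM -muleA [leRHS]muleCA lee_wpmul2l // -int_g.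
    exact: (@ge0_integral_comp_le _ _ _ _ _ mu mu s D1 K g).
  by move=> x _; exact: g0.
rewrite ge0_integral_setU // in ID1 *; last by move=> t _; rewrite lee_fin.
have I00 : 0 <= \int[mu]_(t in D0) (f t)%:E.
  by apply: integral_ge0 => t _; rewrite lee_fin.
have I10 : 0 <= \int[mu]_(t in D1) (f t)%:E.
  by apply: integral_ge0 => t _; rewrite lee_fin.
move: ID1 I00 I10.
case: (\int[mu]_(t in D0) _) => [x| |] //; case: (\int[mu]_(t in D1) _) => [y| |] //.
rewrite -EFinD -!EFinM !lee_fin => h x0 y0 _.
rewrite mulrC ler_pdivlMr ?subr_gt0 //.
by move: h; nra.
Qed.

Lemma ge0_integral_bigcup_le (F : (set T)^nat) (f : T -> \bar R) (c : \bar R) :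
  nondecreasing_seq F -> (forall i, measurable (F i)) ->
  measurable_fun (\bigcup_i F i) f -> (forall t, 0 <= f t) ->
  (forall i, \int[mu]_(t in F i) f t <= c) ->
  \int[mu]_(t in \bigcup_i F i) f t <= c.
Proof.
move=> ndF mF mf f0 Fc.
have mfF i : measurable_fun (F i) f.
  apply: measurable_funS mf; first exact: bigcup_measurable.
  exact: bigcup_sup.
have cv := ge0_nondecreasing_set_cvg_integral (mu := mu) ndF mF mfF (fun i x _ => f0 x).
rewrite -(cvg_lim _ cv) //; apply: lime_le; first exact: cvgP cv.
by apply: nearW => i; exact: Fc.
Qed.

End Contraction.

(** * Spectral radius, real powers, null sets and L^p norms *)

Section Auxiliary.
Context {R : realType}.

Lemma spectral_radius_ge0 (d : nat) (A : 'M[R]_d) : (0 < d)%N ->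
  0 <= spectral_radius A.
Proof.
case: d A => // d A _.
have [P Pu trT] := Schur (map_mx (real_complex R) A) isT.
have {}Pu : P \in unitmx by exact: unitarymx_unit.
have {}trT : is_trig_mx (P *m map_mx (real_complex R) A *m invmx P).
  by rewrite -conjumx //; exact: trT.
exact: le_trans (normc_ge0 _) (spectral_radius_trig Pu trT ord0).
Qed.

Lemma exists_gt_powR_lt1 (K rho p : R) : 0 <= K -> 0 <= rho -> 0 < p ->
  K * rho `^ p < 1 -> exists2 r, rho < r & K * r `^ p < 1.
Proof.
move=> K0 rho0 p0; have [->|Kn0] := eqVneq K 0.
  by exists (rho + 1); rewrite ?ltrDl // mul0r ltr01.
have {}K0 : 0 < K by rewrite lt_def Kn0.
(* [a] solves [K * a ^ p = 1], so [rho < a] and the midpoint of [rho] and [a] works. *)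
move=> h; pose a := K^-1 `^ p^-1.
have ap : a `^ p = K^-1 by rewrite /a -powRrM mulVf ?gt_eqF // powRr1 // invr_ge0 ltW.
have a0 : 0 <= a by exact: powR_ge0.
have rho_a : rho < a.
  rewrite ltNge; apply/negP => ar.
  have := ge0_ler_powR (ltW p0) a0 rho0 ar.
  rewrite ap -(ler_pM2l K0) mulfV //; lra.
exists ((rho + a) / 2); first lra.
rewrite -(ltr_pM2l (_ : 0 < K^-1)) ?invr_gt0 // mulKf // mulr1 -ap.
apply: gt0_ltr_powR => //; rewrite ?nnegrE; lra.
Qed.

Lemma measurable_fun_borel_cV (d : nat) (N : 'cV[R]_d -> R) : continuous N ->
  measurable_fun [set: borel_cV R d] (N : borel_cV R d -> R).
Proof.
move=> /continuousP cN; apply: (measurability _ (RGenOpens.measurableE R)).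
move=> _ [_ [a [b ->]] <-]; rewrite setTI.
by apply: sub_sigma_algebra; apply: cN; exact: itv_open.
Qed.

Lemma measurable_comp_leb (f : R -> R) : measurable_fun [set: R] f ->
  measurable_fun [set: lebR R] (f : lebR R -> R).
Proof. by move=> mf; exact: (measurableT_comp mf measurable_id_borel). Qed.

(** For an arbitrary [X], the hypothesis speaks of the outer measure; its vanishing implies the
    Caratheodory criterion. *)
Lemma leb0_negligible (X : set R) : leb X = 0%E -> (@leb R).-negligible X.
Proof.
move=> X0; exists X; split => //.
apply: le_caratheodory_measurable => Y.
rewrite [X in (X + _)%E](_ : _ = 0%E) ?add0e ?le_outer_measure //.
apply/eqP; rewrite eq_le outer_measure_ge0 andbT -[leRHS]X0.
exact: le_outer_measure.
Qed.

End Auxiliary.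

Section LpNorm.
Context {R : realType}.
Local Open Scope ereal_scope.

Lemma Lp_normE (d : nat) (D : set R) (p : R) (x : R -> 'cV[R]_d) : (0 < p)%R ->
  Lp_norm D p x =
  (\int[leb]_(s in (D : set (lebR R))) (`|x s| `^ p)%:E) `^ p^-1.
Proof.
move=> p0; rewrite /Lp_norm unlock; congr (_ `^ _).
rewrite [RHS]integral_mkcond; apply: eq_integral => s _.
(* Off [D] the integrand is a power of 0, which vanishes because [p] is nonzero. *)
rewrite !patchE; case: ifP => _; last by rewrite abse0 poweR0r // gt_eqF.
by rewrite /= normr_id.
Qed.

End LpNorm.

Lemma ge0_integral_le_scale d (T : measurableType d) (R : realType)
    (mu : {measure set T -> \bar R}) (D E : set T) (f g : T -> R) (c : R) :
  measurable D -> measurable E -> D `<=` E -> 0 <= c ->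
  (forall t, 0 <= f t) -> (forall t, 0 <= g t) ->
  measurable_fun E f -> measurable_fun E g ->
  (forall t, D t -> f t <= c * g t) ->
  (\int[mu]_(t in D) (f t)%:E <= c%:E * \int[mu]_(t in E) (g t)%:E)%E.
Proof.
move=> mD mE DE c0 f0 g0 mf mg fg.
have mgE : measurable_fun E (EFin \o g) by exact/measurable_EFinP.
have cg0 t : (0 <= c%:E * (g t)%:E)%E by rewrite mule_ge0 // lee_fin.
rewrite -ge0_integralZl_EFin //; last by move=> t _; rewrite lee_fin.
apply: (@le_trans _ _ (\int[mu]_(t in D) (c%:E * (g t)%:E))%E).
  apply: ge0_le_integral => //.
  - by move=> t _; rewrite lee_fin.
  - by apply/measurable_EFinP; exact: measurable_funS mf.
  - by apply: measurable_funeM; exact: measurable_funS mgE.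
have mcg : measurable_fun E (fun t => c%:E * (g t)%:E)%E.
  by apply: measurable_funeM; exact: mgE.
exact: (@ge0_subset_integral _ _ _ mu _ _ mD mE _ mcg (fun t _ => cg0 t) DE).
Qed.

Lemma integral_le_Lnorm_pinfty d (T : measurableType d) (R : realType)
    (mu : {measure set T -> \bar R}) (phi : T -> R) (K : R) :
  measurable_fun [set: T] phi -> (forall y, 0 <= phi y) -> 0 <= K ->
  ('N[mu]_+oo[EFin \o phi] <= K%:E)%E ->
  forall B, measurable B ->
  (\int[mu]_(y in B) (phi y)%:E <= K%:E * mu B)%E.
Proof.
move=> mphi phi0 K0 phiK B mB.
have phi_le : \forall y \ae mu, ((phi y)%:E <= K%:E)%E.
  (* The norm is an essential supremum if [mu] is nonzero; otherwise the whole space is null and the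
     bound is trivial. *)
  move: phiK; rewrite unlock; case: ifPn => [_ /ess_supP|mu0 _].
    by apply: filterS => y /=; rewrite ger0_norm.
  exists setT; split => //.
  by apply/eqP; rewrite eq_le measure_ge0 andbT leNgt.
rewrite -integral_cst //; apply: ae_ge0_le_integral => //.
- by move=> y _; rewrite lee_fin.
- by apply: measurable_funTS; exact/measurable_EFinP.
- by apply: filterS phi_le => y h _.
Qed.

(** * The largest delay and the delay map *)

Section DelayMap.
Context {R : realType}.
Variables (tau : R -> R) (M : R).
Hypothesis tau_gt0 : delay_function tau.
Hypothesis tauM : forall t, 0 <= t -> tau t <= M.

(** Boundedness of [tau] makes the infimum in the largest delay a real number [m t], so that all
    domains become real intervals. The last two clauses characterize it as a greatest lower
    bound. *)
Lemma largest_delayE : exists m : R -> R, forall t, 0 <= t ->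
  [/\ largest_delay tau t = (t - m t)%:E, t - M <= m t,
      forall s, t <= s -> m t <= s - tau s &
      forall l, (forall s, t <= s -> l <= s - tau s) -> l <= m t].
Proof.
pose E t := ereal_inf [set (s - tau s)%:E | s in `[t, +oo[%classic].
have lbE t s : t <= s -> (E t <= (s - tau s)%:E)%E.
  by move=> ts; apply: ereal_inf_lbound; exists s => //=; rewrite in_itv /= ts.
have Elb t l : (forall s, t <= s -> l <= s - tau s) -> (l%:E <= E t)%E.
  move=> h; apply: le_ereal_inf_tmp => _ [s /= + <-].
  by rewrite in_itv /= andbT => ts; rewrite lee_fin h.
have lM t : 0 <= t -> forall s, t <= s -> t - M <= s - tau s.
  by move=> t0 s ts; have := tauM (le_trans t0 ts); lra.
exists (fun t => fine (E t)) => t t0.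
have Efin : E t \is a fin_num.
  rewrite fin_numE -ltey -ltNye; apply/andP; split.
    exact: lt_le_trans (ltNyr _) (Elb _ _ (lM t t0)).
  exact: le_lt_trans (lbE t t (lexx t)) (ltry _).
split.
- by rewrite /largest_delay -/(E t) EFinB fineK.
- by rewrite -lee_fin fineK //; exact: Elb (lM t t0).
- by move=> s ts; rewrite -lee_fin fineK //; exact: lbE.
- by move=> l hl; rewrite -lee_fin fineK //; exact: Elb.
Qed.

(* Extending sigma1 by the identity, rather than by a constant, makes the preimage
   of every null set null. *)
Definition delay_map (t : R) : R := if 0 <= t then sigma1 tau t else t.

Hypothesis tau_meas : measurable_fun (Rplus : set (lebR R)) (tau : lebR R -> lebR R).
Hypothesis sigma1_null : forall N : set (lebR R), measurable N -> leb N = 0%E ->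
  leb ([set t : lebR R | Rplus t /\ N (sigma1 tau t)]) = 0%E.

Lemma measurable_Rplus : measurable (Rplus : set (lebR R)).
Proof.
rewrite (_ : Rplus = `[0, +oo[%classic); last first.
  by apply/seteqP; split => t /=; rewrite /Rplus /= in_itv /= andbT.
exact: (borel_leb (measurable_itv _)).
Qed.

(** Both branches are measurable for the Borel target. For the Lebesgue target, the preimage of a
    null set [N] lies in its preimage under [sigma1 tau] on the half-line, null by hypothesis,
    together with [N] itself. *)
Lemma measurable_delay_map :
  measurable_fun [set: lebR R] (delay_map : lebR R -> lebR R).
Proof.
apply: measurable_leb_fun.
  apply: (@measurable_fun_if _ _ (lebR R) (measurableTypeR R) (sigma1 tau) id
    setT _ (fun t : lebR R => (0 <= t)%R)).
  - exact: measurableT.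
  - apply: (measurable_fun_bool true); rewrite setTI.
    exact: measurable_Rplus.
  - rewrite setTI.
    have mt : measurable_fun (Rplus : set (lebR R)) (tau : lebR R -> R).
      exact: (measurableT_comp measurable_id_borel tau_meas).
    exact: (measurable_funB (measurable_funTS (D := (Rplus : set (lebR R)))
      measurable_id_borel) mt).
  - by apply: measurable_funTS; exact: measurable_id_borel.
move=> N mN N0.
apply: (@negligibleS _ _ _ _ ([set t : lebR R | Rplus t /\ N (sigma1 tau t)] `|` N)).
  move=> t; rewrite /delay_map /=; case: ifP => t0 Nt; last by right.
  by left; split.
apply: negligibleU; first exact: leb0_negligible (sigma1_null mN N0).
by exists N; split.
Qed.

Variable phi : R -> R.
Hypothesis phi_RN : is_Radon_Nikodym (pushforward_sigma1 tau) phi.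

(** On the half-line the map is [sigma1 tau], so the left-hand side is the integral over [B] of a
    density at most [K] almost everywhere. *)
Lemma pushforward_le (K : {nonneg R}) : Linfty_norm phi = K%:num%:E ->
  forall B : set (lebR R), measurable B ->
  (leb (delay_map @^-1` B `&` Rplus) <= K%:num%:E * leb B)%E.
Proof.
move=> phiK B mB.
have [phi0 mphi /(_ _ mB) nuB] := phi_RN.
have -> : delay_map @^-1` B `&` Rplus = sigma1 tau @^-1` B `&` Rplus.
  by apply/seteqP; split => t /= [+ t0]; move: (t0); rewrite /delay_map /Rplus /= => ->.
rewrite [leLHS](_ : _ = \int[leb]_(y in B) (phi y)%:E)%E; last exact: nuB.
by apply: integral_le_Lnorm_pinfty => //; rewrite -phiK.
Qed.

End DelayMap.

(** * Weighted estimate for solutions *)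

Lemma le_powR_scale (R : realType) (p b u v : R) : 0 <= p -> 0 <= b ->
  0 <= u -> 0 <= v -> u <= b * v -> u `^ p <= b `^ p * v `^ p.
Proof.
move=> p0 b0 u0 v0 h; rewrite -powRM //.
by apply: ge0_ler_powR => //; rewrite nnegrE // mulr_ge0.
Qed.

Section WeightedEstimate.
Context {R : realType}.
Variables (d : nat) (p : R) (A : 'M[R]_d) (tau : R -> R) (m : R -> R) (M : R).
Hypothesis p_ge1 : 1 <= p.
Hypothesis tau_gt0 : delay_function tau.
Hypothesis tauM : forall t, 0 <= t -> tau t <= M.
(* [m t] is [t - h(t)], where [h] is the largest delay function. *)
Hypothesis mP : forall t, 0 <= t ->
  [/\ largest_delay tau t = (t - m t)%:E, t - M <= m t,
      forall s, t <= s -> m t <= s - tau s &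
      forall l, (forall s, t <= s -> l <= s - tau s) -> l <= m t].

Lemma sol_domainE : sol_domain tau = `[m 0, +oo[%classic.
Proof.
have [h _ _ _] := mP (lexx 0).
apply/seteqP; split => s; rewrite /sol_domain /half_open /= h -EFinN sub0r opprK.
  by rewrite in_itv /= andbT lee_fin => /andP[].
by rewrite in_itv /= andbT lee_fin => ->; rewrite ltry.
Qed.

Lemma init_domainE t : 0 <= t -> init_domain tau t = `[m t - t, 0[%classic.
Proof.
move=> t0; have [h _ _ _] := mP t0.
by apply/seteqP; split => s;
  rewrite /init_domain /half_open /= h in_itv /= opprB lee_fin lte_fin.
Qed.

Lemma inf_delay_lt t : 0 <= t -> m t < t.
Proof.
move=> t0; have [_ _ h _] := mP t0.
by have := h t (lexx t); have := tau_gt0 t0; lra.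
Qed.

Lemma inf_delay0_le t : 0 <= t -> m 0 <= m t.
Proof.
move=> t0; have [_ _ h0 _] := mP (lexx 0); have [_ _ _ h] := mP t0.
by apply: h => s ts; apply: h0; exact: le_trans ts.
Qed.

Hypothesis ms : measurable_fun [set: lebR R] (delay_map tau : lebR R -> lebR R).
Variable K : {nonneg R}.
Hypothesis sK : forall B : set (lebR R), measurable B ->
  (leb (delay_map tau @^-1` B `&` Rplus) <= K%:num%:E * leb B)%E.

Variables (N : 'cV[R]_d -> R) (c r gamma : R).
Hypothesis c_gt0 : 0 < c.
Hypothesis cN : continuous N.
Hypothesis N_ge : forall v, `|v| <= c * N v.
Hypothesis N_le : forall v, N v <= c * `|v|.
Hypothesis NA : forall v, N (A *m v) <= r * N v.
Hypothesis r_ge0 : 0 <= r.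
Hypothesis gamma_gt0 : 0 < gamma.
Hypothesis KL : K%:num * (expR (gamma * M) * r) `^ p < 1.

Let S : set (lebR R) := `[m 0, +oo[%classic.
Let I0 : set (lebR R) := `[m 0, 0[%classic.
Let q := K%:num * (expR (gamma * M) * r) `^ p.

Section Solution.
Variable x : R -> 'cV[R]_d.
Hypothesis x_sol : Lp_solution p A tau x.

Let X (t : lebR R) : R := `|x t| `^ p.
Let F (t : lebR R) : R := (expR (gamma * t) * N (x t)) `^ p.

Lemma adapted_norm_ge0 v : 0 <= N v.
Proof. by rewrite -(pmulr_rge0 _ c_gt0); exact: le_trans (N_ge v). Qed.

Lemma powR_norm_ge0 t : 0 <= X t. Proof. exact: powR_ge0. Qed.
Lemma weighted_ge0 t : 0 <= F t. Proof. exact: powR_ge0. Qed.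

Lemma measurable_solution : measurable_fun S (x : lebR R -> borel_cV R d).
Proof. by have [_ []] := x_sol; rewrite /LB_measurable sol_domainE. Qed.

Lemma measurable_powR_norm : measurable_fun S X.
Proof.
apply: (measurableT_comp (measurable_powR p)).
apply: (measurableT_comp _ measurable_solution).
by apply: measurable_fun_borel_cV => v; exact: norm_continuous.
Qed.

Lemma measurable_weighted : measurable_fun S F.
Proof.
apply: (measurableT_comp (measurable_powR p)).
apply: measurable_funM.
  apply: measurable_funTS.
  apply: (@measurable_comp_leb _ (fun t => expR (gamma * t))).
  by apply: measurableT_comp => //; exact: mulrl_measurable.
apply: (measurableT_comp _ measurable_solution).
exact: measurable_fun_borel_cV.
Qed.

Lemma exponent_ge0 : 0 <= p. Proof. exact: le_trans p_ge1. Qed.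

Lemma weighted_le_powR_norm b t : t <= b -> F t <= (expR (gamma * b) * c) `^ p * X t.
Proof.
move=> tb; apply: le_powR_scale => //.
- exact: exponent_ge0.
- by rewrite mulr_ge0 ?expR_ge0 // ltW.
- by rewrite mulr_ge0 ?expR_ge0 // adapted_norm_ge0.
rewrite -mulrA; apply: ler_pM; rewrite ?expR_ge0 ?adapted_norm_ge0 //.
by rewrite ler_expR ler_pM2l.
Qed.

(** The weight increases with time, so from [b] on it is at least its value at [b]; this factor is
    the source of the decay. *)
Lemma powR_norm_le_weighted b t : b <= t -> X t <= (expR (- (gamma * b)) * c) `^ p * F t.
Proof.
move=> bt; apply: le_powR_scale => //.
- exact: exponent_ge0.
- by rewrite mulr_ge0 ?expR_ge0 // ltW.
- by rewrite mulr_ge0 ?expR_ge0 // adapted_norm_ge0.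
rewrite mulrACA -expRD; apply: le_trans (N_ge _) _.
rewrite mulrA ler_wpM2r ?adapted_norm_ge0 // ler_peMl ?(ltW c_gt0) //.
by rewrite -expR0 ler_expR addrC subr_ge0 ler_pM2l.
Qed.

Lemma weighted_delay_le : {ae (@leb R), forall t : lebR R, Rplus t ->
  F t <= (expR (gamma * M) * r) `^ p * F (delay_map tau t)}.
Proof.
have [/(_ x) xA _] := x_sol.
have {xA} : {ae (@leb R), forall t, Rplus t -> x t = A *m x (t - tau t)}.
  (* Among the representatives of the solution, [x] itself is chosen. *)
  by apply: xA; apply: aeW => t _.
apply: (@filterS _ _ (ae_filter_ringOfSetsType (@leb R))) => t xt t0.
rewrite /delay_map ifT //.
apply: le_powR_scale.
- exact: exponent_ge0.
- by rewrite mulr_ge0 ?expR_ge0.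
- by rewrite mulr_ge0 ?expR_ge0 // adapted_norm_ge0.
- by rewrite mulr_ge0 ?expR_ge0 // adapted_norm_ge0.
rewrite mulrACA -expRD (xt t0); apply: ler_pM; rewrite ?expR_ge0 ?adapted_norm_ge0 //.
(* Going back by [tau t <= M] costs at most a factor [expR (gamma * M)] in the weight. *)
rewrite ler_expR -mulrDr ler_pM2l // /sigma1.
by have := tauM t0; lra.
Qed.

(** The domain contains its left end point, so this interval is a compact subset of it; local
    integrability then provides the finiteness that absorption requires. *)
Lemma integral_powR_norm_itv_fin T :
  (\int[leb]_(t in (`[m 0, T]%classic : set (lebR R))) (X t)%:E < +oo)%E.
Proof.
have [_ [_ /(_ `[m 0, T]%classic)]] := x_sol.
move=> [||_].
- by rewrite sol_domainE; exact: subset_itvl.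
- exact: segment_compact.
rewrite Lp_normE; last exact: lt_le_trans p_ge1.
apply: lty_poweRy; rewrite invr_eq0 gt_eqF //; exact: lt_le_trans p_ge1.
Qed.

(** Absorption is carried out on [[m 0, n]], where the integral is finite. The constant does not
    depend on [n], so monotone convergence extends the bound to the half-line. *)
Lemma integral_weighted_le :
  (\int[leb]_(t in S) (F t)%:E <= ((1 - q)^-1)%:E * \int[leb]_(t in I0) (F t)%:E)%E.
Proof.
pose D n : set (lebR R) := `[0, n%:R]%classic.
have m0 : m 0 < 0 by exact: inf_delay_lt.
have I0D n : I0 `|` D n = `[m 0, n%:R]%classic.
  apply/seteqP; split => t; rewrite /I0 /D /= !in_itv /=.
    move=> [|] /andP[h1 h2]; first by rewrite h1 (le_trans (ltW h2)).
    by rewrite (le_trans (ltW m0)).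
  move=> /andP[h1 h2]; have [t0|t0] := ltP t 0; [left|right]; exact/andP.
have SD : S = \bigcup_n (I0 `|` D n).
  apply/seteqP; split => t.
    rewrite /S /= in_itv /= andbT => mt.
    exists (Num.truncn `|t|).+1 => //; rewrite I0D /= in_itv /= mt /=.
    exact: le_trans (ler_norm _) (ltW (truncnS_gt _)).
  by move=> [n _]; rewrite I0D /S /= !in_itv /= => /andP[->].
have I0DS n : I0 `|` D n `<=` S by rewrite SD => t Dt; exists n.
have mFn n : measurable_fun (I0 `|` D n) F.
  by apply: (measurable_funS (measurable_itv_leb _) (@I0DS n)); exact: measurable_weighted.
have dis n : [disjoint I0 & D n].
  apply/disj_setPS => t; rewrite /I0 /D /= !in_itv /= => -[/andP[_ h1] /andP[h2 _]].
  by move: h1; rewrite ltNge h2.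
pose L : {nonneg R} := NngNum (powR_ge0 (expR (gamma * M) * r) p).
have Ffin n : (\int[leb]_(t in I0 `|` D n) (F t)%:E < +oo)%E.
  pose b := expR (gamma * n%:R) * c.
  apply: (@le_lt_trans _ _ ((b `^ p)%:E * \int[leb]_(t in I0 `|` D n) (X t)%:E)%E).
    apply: ge0_integral_le_scale.
    - by rewrite I0D; exact: measurable_itv_leb.
    - by rewrite I0D; exact: measurable_itv_leb.
    - by [].
    - exact: powR_ge0.
    - exact: weighted_ge0.
    - exact: powR_norm_ge0.
    - exact: mFn.
    - by apply: (measurable_funS (measurable_itv_leb _) (@I0DS n));
        exact: measurable_powR_norm.
    - by move=> t; rewrite I0D /= in_itv /= => /andP[_ tn]; exact: weighted_le_powR_norm.
  rewrite I0D; apply: lte_mul_pinfty.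
  - by rewrite lee_fin powR_ge0.
  - by [].
  - exact: integral_powR_norm_itv_fin.
have bound n : (\int[leb]_(t in I0 `|` D n) (F t)%:E
    <= ((1 - q)^-1)%:E * \int[leb]_(t in I0) (F t)%:E)%E.
  apply: (@integral_contraction _ _ _ (@leb R) I0 (D n) (delay_map tau) K L F).
  - exact: measurable_itv_leb.
  - exact: measurable_itv_leb.
  - exact: dis.
  - exact: weighted_ge0.
  - exact: mFn.
  - exact: ms.
  (* The delayed time stays above [m 0] by the choice of [m], and below [n] because delays are
     positive. *)
  - move=> t; rewrite I0D /D /= !in_itv /= => /andP[t0 tn].
    rewrite /delay_map t0 /sigma1; have [_ _ h _] := mP (lexx 0).
    by rewrite h //=; have := tau_gt0 t0; lra.
  - move=> B mB; apply: le_trans (sK mB); apply: le_measure.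
    + rewrite inE; apply: measurableI; last exact: measurable_itv_leb.
      by rewrite -[X in measurable X]setTI; exact: ms.
    + rewrite inE; apply: measurableI; last exact: measurable_Rplus.
      by rewrite -[X in measurable X]setTI; exact: ms.
    + by apply: setIS => t; rewrite /D /Rplus /= in_itv /= => /andP[].
  - apply: (@filterS _ _ (ae_filter_ringOfSetsType (@leb R)) _ _ _ weighted_delay_le).
    by move=> t h; rewrite /D /= in_itv /= => /andP[t0 _]; exact: h.
  - exact: KL.
  - exact: Ffin.
rewrite SD; apply: ge0_integral_bigcup_le.
- move=> i j ij; rewrite !I0D; apply/subsetPset; apply: subset_itvl.
  by rewrite bnd_simp ler_nat.
- by move=> i; rewrite I0D; exact: measurable_itv_leb.
- by rewrite -SD; apply/measurable_EFinP; exact: measurable_weighted.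
- by move=> t; rewrite lee_fin; exact: weighted_ge0.
- exact: bound.
Qed.

Lemma subr_q_gt0 : 0 < 1 - q. Proof. by rewrite subr_gt0. Qed.

Lemma integral_weighted_le_init :
  (\int[leb]_(t in S) (F t)%:E <=
   ((1 - q)^-1 * c `^ p)%:E * \int[leb]_(t in I0) (X t)%:E)%E.
Proof.
apply: (le_trans integral_weighted_le); rewrite EFinM -muleA.
apply: lee_wpmul2l; first by rewrite lee_fin invr_ge0 ltW // subr_q_gt0.
have I0S : I0 `<=` S by exact: subset_itvl.
apply: ge0_integral_le_scale.
- exact: measurable_itv_leb.
- exact: measurable_itv_leb.
- by [].
- exact: powR_ge0.
- exact: weighted_ge0.
- exact: powR_norm_ge0.
- by apply: (measurable_funS (measurable_itv_leb _) I0S); exact: measurable_weighted.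
- by apply: (measurable_funS (measurable_itv_leb _) I0S); exact: measurable_powR_norm.
(* Initial times are negative, so the weight is at most its value 1 at time 0. *)
- move=> t; rewrite /I0 /= in_itv /= => /andP[_ /ltW /weighted_le_powR_norm].
  by rewrite mulr0 expR0 mul1r.
Qed.

(** Taking [D] to be the whole domain yields global integrability; taking the window [[m t, t)]
    yields the decay. The constant is written as a p-th power in view of the p-th root that
    follows. *)
Lemma integral_powR_norm_le_init (b : R) (D : set (lebR R)) : measurable D -> D `<=` S ->
  (forall t, D t -> b <= t) ->
  (\int[leb]_(t in D) (X t)%:E <=
   ((expR (- (gamma * b)) * c * ((1 - q)^-1 `^ p^-1) * c) `^ p)%:E *
     \int[leb]_(t in I0) (X t)%:E)%E.
Proof.
move=> mD DS Db.
have p0 : 0 < p by exact: lt_le_trans p_ge1.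
apply: (@le_trans _ _ (((expR (- (gamma * b)) * c) `^ p)%:E * \int[leb]_(t in S) (F t)%:E)%E).
  apply: ge0_integral_le_scale.
  - exact: mD.
  - exact: measurable_itv_leb.
  - exact: DS.
  - exact: powR_ge0.
  - exact: powR_norm_ge0.
  - exact: weighted_ge0.
  - exact: measurable_powR_norm.
  - exact: measurable_weighted.
  - by move=> t /Db; exact: powR_norm_le_weighted.
have c0 := ltW c_gt0.
have qp : ((1 - q)^-1 `^ p^-1) `^ p = (1 - q)^-1.
  by rewrite -powRrM mulVf ?gt_eqF // powRr1 // invr_ge0 ltW // subr_q_gt0.
have -> : (expR (- (gamma * b)) * c * ((1 - q)^-1 `^ p^-1) * c) `^ p =
    (expR (- (gamma * b)) * c) `^ p * ((1 - q)^-1 * c `^ p).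
  rewrite -mulrA (@powRM _ (_ * c)) ?mulr_ge0 ?powR_ge0 ?expR_ge0 //.
  by rewrite [in LHS](@powRM _ (_ `^ p^-1)) ?powR_ge0 // qp.
rewrite (EFinM ((_ * c) `^ p)) -[leRHS]muleA.
apply: lee_wpmul2l; first by rewrite lee_fin powR_ge0.
exact: integral_weighted_le_init.
Qed.

(** Translation by [t] carries the history interval into [[m t, t)] and preserves Lebesgue measure,
    so the change of variables applies with constant 1. *)
Lemma integral_history t : 0 <= t ->
  (\int[leb]_(s in (`[(m t - t)%R, 0%R[%classic : set (lebR R))) (X (t + s)%R)%:E <=
   \int[leb]_(s in (`[m t, t[%classic : set (lebR R))) (X s)%:E)%E.
Proof.
move=> t0; pose W : set (lebR R) := `[m t, t[%classic.
have mXW : measurable_fun W (EFin \o X).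
  apply/measurable_EFinP.
  apply: (measurable_funS (measurable_itv_leb _) _ measurable_powR_norm).
  move=> s; rewrite /W /S /= !in_itv /= => /andP[h _].
  by rewrite andbT (le_trans (inf_delay0_le t0)).
pose g := (EFin \o X) \_ W.
have mg : measurable_fun [set: lebR R] g.
  by apply/(measurable_restrictT _ (measurable_itv_leb _)).1.
have g0 s : (0 <= g s)%E.
  by apply: erestrict_ge0 => y _; rewrite lee_fin; exact: powR_norm_ge0.
pose D : set (lebR R) := `[m t - t, 0[%classic.
have -> : (\int[leb]_(s in D) (X (t + s)%R)%:E = \int[leb]_(s in D) g (t + s)%R)%E.
  apply: eq_integral => s; rewrite inE /D /= in_itv /= => /andP[h1 h2].
  rewrite /g patchE ifT // inE /W /= in_itv /=.
  by apply/andP; split; lra.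
rewrite [leRHS]integral_mkcond -[leRHS]mul1e.
apply: (@ge0_integral_comp_le _ _ _ _ _ (@leb R) (@leb R)
  (fun s => t + s)%R D (NngNum (@ler01 R)) g).
- exact: measurable_itv_leb.
- exact: measurable_translate.
- move=> B mB; rewrite mul1e -[leRHS](leb_translate t).
  apply: le_measure; [| |exact: subIsetl]; rewrite inE.
    apply: measurableI; last exact: measurable_itv_leb.
    by rewrite -[X in measurable X]setTI; exact: measurable_translate.
  by rewrite -[X in measurable X]setTI; exact: measurable_translate.
- exact: mg.
- exact: g0.
Qed.

Lemma poweR_inv_le (a : R) (I J : \bar R) : 0 <= a -> (0 <= I)%E -> (0 <= J)%E ->
  (I <= (a `^ p)%:E * J)%E -> (I `^ p^-1 <= a%:E * J `^ p^-1)%E.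
Proof.
move=> a0 I0' J0 IJ; have p0 : 0 < p by exact: lt_le_trans p_ge1.
have -> : a%:E = ((a `^ p)%:E `^ p^-1)%E.
  by rewrite poweR_EFin -powRrM mulfV ?gt_eqF // powRr1.
rewrite -poweRM ?lee_fin ?powR_ge0 //.
apply: gt0_ler_poweR => //; first by rewrite invr_ge0 ltW.
  by rewrite in_itv /= I0' leey.
by rewrite in_itv /= leey andbT mule_ge0 // lee_fin powR_ge0.
Qed.

Let C := expR (gamma * M) * c * ((1 - q)^-1 `^ p^-1) * c.

Lemma Lp_decay : Lp (init_domain tau 0) p x ->
  Lp (sol_domain tau) p x /\
  forall t : R, 0 <= t ->
    (Lp_norm (init_domain tau t) p (history x t) <=
     (C * expR (- (gamma * t)))%:E * Lp_norm (init_domain tau 0) p x)%E.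
Proof.
have p0 : 0 < p by exact: lt_le_trans p_ge1.
have c0 := ltW c_gt0.
have IX D : (0 <= \int[leb]_(s in D) (X s)%:E)%E.
  by apply: integral_ge0 => s _; rewrite lee_fin; exact: powR_norm_ge0.
have init0 : Lp_norm (init_domain tau 0) p x =
    ((\int[leb]_(s in I0) (X s)%:E) `^ p^-1)%E.
  by rewrite init_domainE // subr0 Lp_normE.
rewrite /Lp init0 => -[_ fin0].
have {}fin0 : (\int[leb]_(s in I0) (X s)%:E < +oo)%E.
  by move: fin0; apply: lty_poweRy; rewrite invr_eq0 gt_eqF.
split; first split.
- by have [_ []] := x_sol.
- rewrite sol_domainE Lp_normE //; apply: poweR_lty.
  apply: le_lt_trans (@integral_powR_norm_le_init (m 0) S (measurable_itv_leb _) _ _) _.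
  + by [].
  + by move=> t; rewrite /S /= in_itv /= andbT.
  + by apply: lte_mul_pinfty; rewrite ?lee_fin ?powR_ge0.
move=> t t0.
rewrite init_domainE // Lp_normE //; apply: poweR_inv_le.
- by rewrite /C !mulr_ge0 ?expR_ge0 ?powR_ge0.
- by apply: integral_ge0 => s _; rewrite lee_fin powR_ge0.
- exact: IX.
apply: (le_trans (integral_history t0)).
(* The window [[m t, t)] starts no earlier than [t - M]; the bound is used with [b = t - M], whence
   the factor [expR (gamma * M)] in [C]. *)
have -> : C * expR (- (gamma * t)) =
    expR (- (gamma * (t - M))) * c * ((1 - q)^-1 `^ p^-1) * c.
  have -> : - (gamma * (t - M)) = gamma * M + - (gamma * t) by ring.
  by rewrite /C expRD; ring.
apply: integral_powR_norm_le_init.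
- exact: measurable_itv_leb.
- move=> s; rewrite /S /= !in_itv /= => /andP[h _].
  by rewrite andbT (le_trans (inf_delay0_le t0)).
- move=> s; rewrite /= in_itv /= => /andP[h _]; apply: le_trans h.
  by have [_ ] := mP t0.
Qed.

End Solution.
End WeightedEstimate.

(** * Choice of the constants *)

Theorem theorem5p21 (R : realType) (d : nat) (hd : (0 < d)%N)
    (p : R) (hp : 1 <= p) (A : 'M[R]_d)
    (tau : R -> R) (htau : delay_function tau) (tau_bounded : bounded_delay tau)
    (tau_inf : forall t : R, 0 <= t -> 0 < inf [set tau s | s in `[0, t]])
    (tau_meas : measurable_fun (Rplus : set (lebR R)) (tau : lebR R -> lebR R))
    (sigma1_null : forall N : set (lebR R), measurable N -> leb N = 0%E ->
       leb ([set t : lebR R | Rplus t /\ N (sigma1 tau t)]) = 0%E)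
    (push_sfinite : sigma_finite [set: lebR R] (pushforward_sigma1 tau))
    (phi : R -> R) (phi_RN : is_Radon_Nikodym (pushforward_sigma1 tau) phi)
    (phi_bounded : (Linfty_norm phi < +oo)%E)
    (phi_rho : (Linfty_norm phi * (spectral_radius A `^ p)%:E < 1)%E) :
  exists C gamma : R, [/\ 0 < C, 0 < gamma &
    forall x : R -> 'cV[R]_d,
      Lp_solution p A tau x ->
      Lp (init_domain tau 0) p x ->
      Lp (sol_domain tau) p x /\
      forall t : R, 0 <= t ->
        (Lp_norm (init_domain tau t) p (history x t) <=
         (C * expR (- (gamma * t)))%:E * Lp_norm (init_domain tau 0) p x)%E].
Proof.
have [M tauM] := tau_bounded.
have M_gt0 : 0 < M.
  by apply: lt_le_trans (tauM 0 (lexx 0)); exact: htau.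
have [m mP] := largest_delayE tauM.
have phi0 : (0 <= Linfty_norm phi)%E by exact: Lnorm_ge0.
have fin_phi : Linfty_norm phi \is a fin_num by rewrite ge0_fin_numE.
pose K : {nonneg R} := NngNum (fine_ge0 phi0).
have phiK : Linfty_norm phi = K%:num%:E by rewrite /K /= fineK.
have p_gt0 : 0 < p by exact: lt_le_trans hp.
have rho0 := spectral_radius_ge0 A hd.
have Krho : K%:num * spectral_radius A `^ p < 1.
  by move: phi_rho; rewrite phiK -EFinM lte_fin.
have K_ge0 : 0 <= K%:num by [].
have [r1 rho_r1 Kr1] := exists_gt_powR_lt1 K_ge0 rho0 p_gt0 Krho.
(* The strict gap on both sides is used: [r] above the spectral radius gives the adapted norm, [r]
   below [r1] leaves room for the exponential weight. *)
pose r := (spectral_radius A + r1) / 2.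
have rho_r : spectral_radius A < r by rewrite /r; lra.
have r_gt0 : 0 < r by exact: le_lt_trans rho_r.
have r_r1 : r < r1 by rewrite /r; lra.
have [N [c [c_gt0 cN N_ge N_le NA]]] := adapted_norm hd rho_r.
(* Chosen so that [expR (gamma * M) * r] is exactly [r1], for which the contraction condition is
   known. *)
pose gamma := ln (r1 / r) / M.
have gamma_gt0 : 0 < gamma.
  by rewrite /gamma divr_gt0 // ln_gt0 // ltr_pdivlMr // mul1r.
have r1_gt0 : 0 < r1 by exact: lt_trans r_r1.
have er : expR (gamma * M) * r = r1.
  by rewrite /gamma mulfVK ?gt_eqF // lnK ?mulfVK ?gt_eqF // posrE divr_gt0.
have KL : K%:num * (expR (gamma * M) * r) `^ p < 1 by rewrite er.
have ms := measurable_delay_map tau_meas sigma1_null.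
have sK := pushforward_le phi_RN phiK.
set q := K%:num * (expR (gamma * M) * r) `^ p in KL.
exists (expR (gamma * M) * c * ((1 - q)^-1 `^ p^-1) * c), gamma; split=> //.
  by rewrite !mulr_gt0 ?expR_gt0 ?powR_gt0 ?invr_gt0 ?subr_gt0.
move=> x xsol x0.
exact: (Lp_decay hp htau tauM mP ms sK c_gt0 cN N_ge N_le NA (ltW r_gt0) gamma_gt0 KL xsol x0).
Qed.
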